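(* Let $A\in\mathbb{R}^{n\times n}$ be diagonalizable over $\mathbb{C}$ ($A$ may be singular), let $\boldsymbol{b}\in\mathcal{R}(A)$, let $\boldsymbol{x}_0\in\mathbb{R}^n$ and $\boldsymbol{r}_0=\boldsymbol{b}-A\boldsymbol{x}_0$, and let $d$ be the grade of the Krylov subspaces $\mathcal{K}_k(A,\boldsymbol{r}_0)$. Let $\boldsymbol{r}_0=c_1\boldsymbol{v}_1+c_2\boldsymbol{v}_2+\dots+c_d\boldsymbol{v}_d$, where $\boldsymbol{v}_i\in\mathbb{C}^n$ with $\|\boldsymbol{v}_i\|_2=1$ are eigenvectors of $A$ corresponding to nonzero eigenvalues $\lambda_i\in\mathbb{C}$ ($i=1,\dots,d$), and $c_i\in\mathbb{C}$ are the corresponding weights. Assume $\lambda_i\neq\lambda_j$ whenever $i\neq j$. Then for every integer $k\geq 1$, $$\min_{\boldsymbol{x}_k=\boldsymbol{x}_0+\boldsymbol{z}_k,\ \boldsymbol{z}_k\in\mathcal{K}_k(A,\boldsymbol{r}_0)}\|\boldsymbol{b}-A\boldsymbol{x}_k\|_2\;\leq\;\|V_d\,\mathrm{diag}[c_1,c_2,\dots,c_d]\|_2\;\min_{\boldsymbol{y}_k\in\mathbb{C}^k}\|\Lambda_d^k\boldsymbol{y}_k-[1,1,\dots,1]^{\top}\|_2,$$ where $V_d=[\boldsymbol{v}_1,\boldsymbol{v}_2,\dots,\boldsymbol{v}_d]\in\mathbb{C}^{n\times d}$ and $\Lambda_d^k\in\mathbb{C}^{d\times k}$ is the Vandermonde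 matrix whose $(i,l)$ entry is $\lambda_i^l$ ($1\leq i\leq d$, $1\leq l\leq k$).
   Context: $\mathcal{R}(A)$ is the range of $A$. The Krylov subspace is $\mathcal{K}_k(A,\boldsymbol{r}_0)=\mathrm{span}\{\boldsymbol{r}_0,A\boldsymbol{r}_0,\dots,A^{k-1}\boldsymbol{r}_0\}$. The grade $d$ is the smallest integer such that $\mathcal{K}_d(A,\boldsymbol{r}_0)=\mathcal{K}_{d+1}(A,\boldsymbol{r}_0)$. Elements $\boldsymbol{x}_k$ are written $\boldsymbol{x}_k=\boldsymbol{x}_0+[\boldsymbol{r}_0,A\boldsymbol{r}_0,\dots,A^{k-1}\boldsymbol{r}_0]\boldsymbol{y}_k$ with coefficient vector $\boldsymbol{y}_k$. The matrix norm $\|\cdot\|_2$ is the spectral (operator) norm, and $[1,\dots,1]^\top\in\mathbb{C}^d$ is the all-ones vector. *)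

(* Defs.v *)
From mathcomp Require Import all_boot all_order all_algebra.
From mathcomp Require Import complex.
From mathcomp Require Import boolp classical_sets reals.

Set Implicit Arguments.
Unset Strict Implicit.
Unset Printing Implicit Defensive.

Import Order.TTheory GRing.Theory Num.Theory.

Local Open Scope classical_set_scope.
Local Open Scope complex_scope.
Local Open Scope ring_scope.

Definition rnorm2 (R : realType) (n : nat) (x : 'cV[R]_n) : R :=
  Num.sqrt (\sum_(i < n) x i 0 ^+ 2).

Definition cnorm2 (R : realType) (n : nat) (x : 'cV[R[i]]_n) : R :=
  Num.sqrt (\sum_(i < n) ComplexField.Normc.normc (x i 0) ^+ 2).

(* The unit ball, rather than the unit sphere, keeps the set nonempty when
   [n = 0]. *)
Definition spectral_norm (R : realType) (m n : nat) (M : 'M[R[i]]_(m, n)) : R :=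
  sup [set cnorm2 (M *m x) | x in [set x : 'cV[R[i]]_n | cnorm2 x <= 1]].

Definition complexify (R : realType) (m n : nat) (M : 'M[R]_(m, n)) :
    'M[R[i]]_(m, n) :=
  map_mx (real_complex R) M.

Definition krylov (R : realType) (n : nat) (A : 'M[R]_n) (r : 'cV[R]_n)
    (k : nat) : {vspace 'cV[R]_n} :=
  <<[seq A ^+ j *m r | j <- iota 0 k]>>%VS.

(* Indices start at [krylov A r 0 = 0], so the grade of [r = 0] is 0. *)
Definition is_grade (R : realType) (n : nat) (A : 'M[R]_n) (r : 'cV[R]_n)
    (d : nat) : Prop :=
  krylov A r d = krylov A r d.+1 /\
  forall j : nat, krylov A r j = krylov A r j.+1 -> (d <= j)%N.

(* Powers run from 1 to k, unlike the library's [Vandermonde], which starts at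
   power 0 and is transposed. *)
Definition vandermonde1 (R : realType) (d k : nat) (lambda : 'I_d -> R[i]) :
    'M[R[i]]_(d, k) :=
  \matrix_(i < d, l < k) lambda i ^+ l.+1.

Definition is_min (R : realType) (S : set R) (m : R) : Prop :=
  S m /\ lbound S m.

(* Main.v *)
Require Import Defs.
From mathcomp Require Import all_boot all_order all_algebra.
From mathcomp Require Import complex.
From mathcomp Require Import boolp classical_sets reals.

Set Implicit Arguments.
Unset Strict Implicit.
Unset Printing Implicit Defensive.

Import Order.TTheory GRing.Theory Num.Theory.

Local Open Scope classical_set_scope.
Local Open Scope complex_scope.
Local Open Scope ring_scope.

(* Multiplying [Lambda y - 1] by [V diag(c)] gives [sum_l y_l A^l r0 - r0],
   whose real part is minus the residual of an element of [x0 + K_k(A, r0)].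
   Passing to real parts does not increase the 2-norm, and the spectral norm
   bounds the product. Both minima exist because the normal equations
   [B^T B y = B^T t] are always solvable. *)

(** * Real least squares through the normal equations *)

Lemma mul_trmx_self (R : realType) n (x : 'cV[R]_n) :
  (x^T *m x) 0 0 = \sum_(i < n) x i 0 ^+ 2.
Proof. by rewrite mxE; apply: eq_bigr => i _; rewrite mxE expr2. Qed.

(** The [j]-th diagonal entry of [M^T *m M] is the sum of the squares of column [j], and over the
    reals such a sum vanishes only termwise. *)
Lemma gram_eq0 (R : realType) m n (M : 'M[R]_(m, n)) :
  M^T *m M = 0 -> M = 0.
Proof.
move=> M0; apply/matrixP => i j; rewrite [RHS]mxE; apply/eqP.
rewrite -sqrf_eq0; apply/eqP; move/matrixP/(_ j j): M0.
rewrite !mxE => /eqP; rewrite psumr_eq0 => [/allP/(_ i)|l _].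
  by rewrite mem_index_enum mxE -expr2 => /(_ isT)/eqP.
by rewrite mxE -expr2 sqr_ge0.
Qed.

Lemma normal_equations (R : realType) m p (B : 'M[R]_(m, p)) (t : 'cV[R]_m) :
  exists y : 'cV[R]_p, B^T *m (B *m y - t) = 0.
Proof.
have /submxP[D tD] : (t^T *m B <= B^T *m B)%MS.
  (* The row space of [B] lies in that of [B^T *m B]: if [C] is the cokernel of [B^T *m B], then
     [(B C)^T (B C) = C^T (B^T B C) = 0], hence [B C = 0]. *)
  apply: submx_trans (submxMl _ _) _; rewrite submxE; apply/eqP/gram_eq0.
  by rewrite trmx_mul -mulmxA [X in _ *m X]mulmxA mulmx_coker mulmx0.
exists D^T; rewrite mulmxBr mulmxA.
have -> : B^T *m t = (t^T *m B)^T by rewrite trmx_mul trmxK.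
by rewrite tD !trmx_mul trmxK subrr.
Qed.

(** Pythagoras: a solution [y] of the normal equations has a residual [u] orthogonal to the range of
    [B], and any other residual is [w + u] with [w] in that range. *)
Lemma real_least_squares (R : realType) m p (B : 'M[R]_(m, p)) (t : 'cV[R]_m) :
  exists y, forall y', rnorm2 (B *m y - t) <= rnorm2 (B *m y' - t).
Proof.
have [y yP] := normal_equations B t.
exists y => y'; apply: ler_wsqrtr; rewrite -!mul_trmx_self.
set u := B *m y - t; set w := B *m (y' - y).
have -> : B *m y' - t = w + u by rewrite /w mulmxBr addrA subrK.
have wu : w^T *m u = 0 by rewrite trmx_mul -mulmxA yP mulmx0.
have uw : u^T *m w = 0 by rewrite -[LHS]trmxK trmx_mul trmxK wu trmx0.
have -> : (w + u)^T = w^T + u^T by rewrite linearD.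
move: u w wu uw {yP} => u w wu uw.
rewrite mulmxDl !mulmxDr wu uw addr0 add0r [leRHS]mxE lerDr mul_trmx_self.
by rewrite sumr_ge0 // => i _; rewrite sqr_ge0.
Qed.

(** * Complex least squares by reduction to the real case *)

Lemma normc_sqrE (R : realType) (z : R[i]) :
  Normc.normc z ^+ 2 = complex.Re z ^+ 2 + complex.Im z ^+ 2.
Proof. by case: z => a b /=; rewrite sqr_sqrtr // addr_ge0 ?sqr_ge0. Qed.

(** The isometric real-linear identification of complex [n]-space with real [2n]-space, which
    carries complex minimization problems to real ones. *)
Definition realify (R : realType) n (x : 'cV[R[i]]_n) : 'cV[R]_(n + n) :=
  col_mx (map_mx (@complex.Re R) x) (map_mx (@complex.Im R) x).

Lemma cnorm2_realify (R : realType) n (x : 'cV[R[i]]_n) :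
  cnorm2 x = rnorm2 (realify x).
Proof.
rewrite /cnorm2 /rnorm2 big_split_ord /= -big_split /=; congr Num.sqrt.
by apply: eq_bigr => i _; rewrite normc_sqrE col_mxEu col_mxEd !mxE.
Qed.

Lemma realifyB (R : realType) n (x y : 'cV[R[i]]_n) :
  realify (x - y) = realify x - realify y.
Proof.
rewrite /realify opp_col_mx add_col_mx; congr col_mx; apply/matrixP => i j;
  by rewrite !mxE raddfB.
Qed.

(** The block matrix is the usual real representation of a complex matrix, read off from [(a + ib)(c
    + ie) = (ac - be) + i(ae + bc)]. *)
Lemma realifyM (R : realType) m n (M : 'M[R[i]]_(m, n)) (x : 'cV[R[i]]_n) :
  realify (M *m x) =
  block_mx (map_mx (@complex.Re R) M) (- map_mx (@complex.Im R) M)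
           (map_mx (@complex.Im R) M) (map_mx (@complex.Re R) M) *m realify x.
Proof.
rewrite /realify mul_block_col mulNmx; congr col_mx; apply/matrixP => i j;
  rewrite !mxE raddf_sum /= -?sumrB -?big_split /=; apply: eq_bigr => l _;
  rewrite !mxE; case: (M i l) (x l j) => [a b] [c e] //=.
by rewrite addrC.
Qed.

Lemma realify_surj (R : realType) n (u : 'cV[R]_(n + n)) :
  exists x, realify x = u.
Proof.
exists (\col_i (usubmx u i 0 +i* dsubmx u i 0)).
rewrite -[RHS]vsubmxK; congr col_mx; apply/matrixP => i j;
  by rewrite ord1 !mxE.
Qed.

Lemma complex_least_squares (R : realType) m p (B : 'M[R[i]]_(m, p))
    (t : 'cV[R[i]]_m) :
  exists y, forall y', cnorm2 (B *m y - t) <= cnorm2 (B *m y' - t).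
Proof.
pose B' := block_mx (map_mx (@complex.Re R) B) (- map_mx (@complex.Im R) B)
                    (map_mx (@complex.Im R) B) (map_mx (@complex.Re R) B).
have [u uP] := real_least_squares B' (realify t).
(* The real minimizer comes from a complex vector, so no minimum is lost by passing to the reals. *)
have [y yu] := realify_surj u.
by exists y => y'; rewrite !cnorm2_realify !realifyB !realifyM yu.
Qed.

(** * Norm estimates and the spectral norm *)

Lemma rnorm2_Re (R : realType) n (x : 'cV[R[i]]_n) :
  rnorm2 (map_mx (@complex.Re R) x) <= cnorm2 x.
Proof.
apply: ler_wsqrtr; apply: ler_sum => i _.
by rewrite normc_sqrE mxE lerDl sqr_ge0.
Qed.

Lemma rnorm2N (R : realType) n (x : 'cV[R]_n) : rnorm2 (- x) = rnorm2 x.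
Proof. by congr Num.sqrt; apply: eq_bigr => i _; rewrite mxE sqrrN. Qed.

Lemma cnorm2_ge0 (R : realType) n (x : 'cV[R[i]]_n) : 0 <= cnorm2 x.
Proof. exact: sqrtr_ge0. Qed.

Lemma normc_ge0 (R : realType) (z : R[i]) : 0 <= Normc.normc z.
Proof. by case: z => a b; exact: sqrtr_ge0. Qed.

Lemma normc_le_cnorm2 (R : realType) n (x : 'cV[R[i]]_n) i :
  Normc.normc (x i 0) <= cnorm2 x.
Proof.
rewrite -[leLHS]ger0_norm ?normc_ge0 // -sqrtr_sqr; apply: ler_wsqrtr.
by rewrite (bigD1 i) //= lerDl sumr_ge0 // => j _; rewrite sqr_ge0.
Qed.

Lemma cnorm2_eq0 (R : realType) n (x : 'cV[R[i]]_n) : cnorm2 x = 0 -> x = 0.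
Proof.
move=> x0; apply/matrixP => i j; rewrite ord1 [RHS]mxE.
apply: Normc.eq0_normc; apply/eqP.
by rewrite eq_le normc_ge0 andbT -x0 normc_le_cnorm2.
Qed.

Lemma cnorm2Z (R : realType) n (z : R[i]) (x : 'cV[R[i]]_n) :
  cnorm2 (z *: x) = Normc.normc z * cnorm2 x.
Proof.
rewrite -[X in X * _]ger0_norm ?normc_ge0 // -sqrtr_sqr -sqrtrM ?sqr_ge0 //.
congr Num.sqrt; rewrite mulr_sumr; apply: eq_bigr => i _.
by rewrite mxE Normc.normcM exprMn.
Qed.

Lemma normc_sum (R : realType) n (F : 'I_n -> R[i]) :
  Normc.normc (\sum_i F i) <= \sum_i Normc.normc (F i).
Proof.
elim/big_ind2: _ => [|z r z' r' zr zr'|//]; first by rewrite Normc.normc0.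
exact: le_trans (le_normcD _ _) (lerD zr zr').
Qed.

(** Entries of a vector in the unit ball have modulus at most 1, so each entry of [M *m x] is
    bounded by an absolute row sum of [M]. This makes the [sup] in [spectral_norm] a genuine
    supremum. *)
Lemma cnorm2_unit_ball_bounded (R : realType) m n (M : 'M[R[i]]_(m, n)) :
  has_ubound [set cnorm2 (M *m x) | x in [set x : 'cV[R[i]]_n | cnorm2 x <= 1]].
Proof.
exists (Num.sqrt (\sum_i (\sum_j Normc.normc (M i j)) ^+ 2)).
move=> _ [x /= x1 <-]; apply: ler_wsqrtr; apply: ler_sum => i _.
rewrite lerXn2r ?nnegrE ?normc_ge0 ?sumr_ge0 //
  => [j _|]; first exact: normc_ge0.
rewrite mxE; apply: le_trans (normc_sum _) _; apply: ler_sum => j _.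
rewrite Normc.normcM ler_piMr ?normc_ge0 //.
exact: le_trans (normc_le_cnorm2 _ _) x1.
Qed.

Lemma spectral_normP (R : realType) m n (M : 'M[R[i]]_(m, n))
    (x : 'cV[R[i]]_n) :
  cnorm2 (M *m x) <= spectral_norm M * cnorm2 x.
Proof.
have [x0|x_neq0] := eqVneq (cnorm2 x) 0.
  rewrite x0 mulr0 (cnorm2_eq0 x0) -(scale0r 0) -scalemxAr cnorm2Z.
  by rewrite Normc.normc0 mul0r.
have x_gt0 : 0 < cnorm2 x by rewrite lt_def x_neq0 cnorm2_ge0.
rewrite -ler_pdivrMr //.
have normcV : Normc.normc ((cnorm2 x)^-1%:C) = (cnorm2 x)^-1.
  by rewrite /= expr0n addr0 sqrtr_sqr ger0_norm // invr_ge0 cnorm2_ge0.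
(* The nonzero vector [x], scaled to norm 1, is the point of the unit ball to test. *)
apply: ub_le_sup; first exact: cnorm2_unit_ball_bounded.
exists ((cnorm2 x)^-1%:C *: x) => /=; first by rewrite cnorm2Z normcV mulVf.
by rewrite -scalemxAr cnorm2Z normcV mulrC.
Qed.

(** * Krylov subspaces and the eigenvector expansion *)

Definition krylov_image_mx (R : realType) n (A : 'M[R]_n) (r : 'cV[R]_n) k :
    'M[R]_(n, k) :=
  \matrix_(i < n, l < k) (A ^+ l.+1 *m r) i 0.

(** One factor [A] comes out of every column, whose powers run from 1 to [k]. Minimizing the
    residual over the Krylov subspace thus becomes least squares in the coefficients [y]. *)
Lemma krylov_image_mxE (R : realType) n (A : 'M[R]_n) (r : 'cV[R]_n) k
    (y : 'cV[R]_k) :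
  krylov_image_mx A r k *m y = A *m \sum_(l < k) y l 0 *: (A ^+ l *m r).
Proof.
rewrite mulmx_sumr; apply/matrixP => i j; rewrite ord1 summxE mxE.
apply: eq_bigr => l _; rewrite -scalemxAr mulmxA [in LHS]mxE [RHS]mxE mulrC.
by rewrite exprS.
Qed.

Lemma krylov_combP (R : realType) n (A : 'M[R]_n) (r : 'cV[R]_n) k z :
  reflect (exists y : 'cV[R]_k, z = \sum_(l < k) y l 0 *: (A ^+ l *m r))
          (z \in krylov A r k).
Proof.
apply: (iffP idP) => [zK|[y ->]]; last first.
  apply: memv_suml => l _; apply/memvZ/memv_span/map_f.
  by rewrite mem_iota /=.
have sz : size [seq A ^+ j *m r | j <- iota 0 k] == k.
  by rewrite size_map size_iota.
(* The spanning vectors may be linearly dependent; [coord] still gives valid coefficients for any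
   vector of the span. *)
exists (\col_l coord (Tuple sz) l z).
rewrite [LHS](@coord_span _ _ _ (Tuple sz)) //; apply: eq_bigr => l _.
by rewrite mxE /= (nth_map 0%N) ?size_iota // nth_iota.
Qed.

Lemma expmx_eigen (R : realType) n (A : 'M[R]_n) (v : 'cV[R[i]]_n) lam j :
  complexify A *m v = lam *: v ->
  complexify (A ^+ j) *m v = lam ^+ j *: v.
Proof.
move=> Av; elim: j => [|j IHj].
  by rewrite !expr0 /complexify map_mx1 mul1mx scale1r.
rewrite exprSr /complexify map_mxM -mulmxA -/(complexify A) Av -scalemxAr IHj.
by rewrite scalerA -exprS.
Qed.

(** Applying [A ^+ l.+1] to the expansion of [r] multiplies its [j]-th term by [lambda j ^+ l.+1],
    which is the Vandermonde entry [(j, l)]. *)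
Lemma mul_eigenvectors_vandermonde1 (R : realType) n (A : 'M[R]_n)
    (r : 'cV[R]_n) d (v : 'I_d -> 'cV[R[i]]_n) (lambda c : 'I_d -> R[i]) k :
  (forall i, complexify A *m v i = lambda i *: v i) ->
  complexify r = \sum_(i < d) c i *: v i ->
  ((\matrix_(i < n, j < d) v j i 0) *m diag_mx (\row_(j < d) c j))
    *m vandermonde1 k lambda = complexify (krylov_image_mx A r k).
Proof.
move=> v_eigen r_decomp; apply/matrixP => i l.
have -> : complexify (krylov_image_mx A r k) i l
    = (complexify (A ^+ l.+1) *m complexify r) i 0.
  by rewrite /complexify -map_mxM !mxE.
rewrite r_decomp mulmx_sumr summxE [LHS]mxE; apply: eq_bigr => j _.
rewrite -scalemxAr (expmx_eigen _ (v_eigen j)) mul_mx_diag !mxE.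
by rewrite mulrAC mulrC mulrA mulrAC -mulrA.
Qed.

Lemma mul_eigenvectors_const1 (R : comPzRingType) n d (v : 'I_d -> 'cV[R]_n)
    (c : 'I_d -> R) :
  ((\matrix_(i < n, j < d) v j i 0) *m diag_mx (\row_(j < d) c j))
    *m const_mx 1 = \sum_(i < d) c i *: v i.
Proof.
apply/matrixP => i j; rewrite ord1 summxE mxE; apply: eq_bigr => l _.
by rewrite mul_mx_diag !mxE mulr1 mulrC.
Qed.

Lemma complexifyK (R : realType) m n :
  cancel (@complexify R m n) (map_mx (@complex.Re R)).
Proof. by move=> M; apply/matrixP => i j; rewrite !mxE. Qed.

Lemma Re_complexify_mul (R : realType) m n (M : 'M[R]_(m, n))
    (x : 'cV[R[i]]_n) :
  map_mx (@complex.Re R) (complexify M *m x) = M *m map_mx (@complex.Re R) x.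
Proof.
apply/matrixP => i j; rewrite !mxE raddf_sum; apply: eq_bigr => l _.
by rewrite !mxE; case: (x l j) => a e /=; rewrite mul0r subr0.
Qed.

Theorem theorem1 (R : realType) (n : nat) (A : 'M[R]_n) (b x0 : 'cV[R]_n)
    (d : nat) (v : 'I_d -> 'cV[R[i]]_n) (lambda c : 'I_d -> R[i]) (k : nat)
    (A_diag : diagonalizable (complexify A))
    (b_range : range (fun w : 'cV[R]_n => A *m w) b)
    (d_grade : is_grade A (b - A *m x0) d)
    (v_unit : forall i : 'I_d, cnorm2 (v i) = 1)
    (v_eigen : forall i : 'I_d, complexify A *m v i = lambda i *: v i)
    (lambda_neq0 : forall i : 'I_d, lambda i != 0)
    (lambda_inj : forall i j : 'I_d, i != j -> lambda i != lambda j)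
    (r0_decomp : complexify (b - A *m x0) = \sum_(i < d) c i *: v i)
    (k_ge1 : (1 <= k)%N) :
  exists mu nu : R,
    [/\ is_min [set rnorm2 (b - A *m (x0 + z)) |
                 z in [set z : 'cV[R]_n | z \in krylov A (b - A *m x0) k]] mu,
        is_min [set cnorm2 (vandermonde1 k lambda *m y - const_mx 1) |
                 y in [set: 'cV[R[i]]_k]] nu
      & mu <= spectral_norm ((\matrix_(i < n, j < d) v j i 0) *m
                             diag_mx (\row_(j < d) c j)) * nu].
Proof.
set r := b - A *m x0; set M := _ *m diag_mx _.
pose B := krylov_image_mx A r k.
(* For [z] with coefficients [y], [b - A (x0 + z) = r - B y]; the sign is flipped to fit the
   least-squares form. *)
have residualE (y : 'cV_k) :
    rnorm2 (b - A *m (x0 + \sum_(l < k) y l 0 *: (A ^+ l *m r)))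
    = rnorm2 (B *m y - r).
  by rewrite mulmxDr opprD addrA -krylov_image_mxE -opprB rnorm2N.
have [y yP] := real_least_squares B r.
have [w wP] := complex_least_squares (vandermonde1 k lambda) (const_mx 1).
exists (rnorm2 (B *m y - r)),
       (cnorm2 (vandermonde1 k lambda *m w - const_mx 1)).
split.
- split=> [|_ [z /= /krylov_combP[y' ->] <-]]; last by rewrite residualE.
  exists (\sum_(l < k) y l 0 *: (A ^+ l *m r)) => //=.
  by apply/krylov_combP; exists y.
- by split=> [|_ [w' _ <-]]; [exists w | exact: wP].
apply: le_trans (spectral_normP _ _).
rewrite mulmxBr mulmxA (mul_eigenvectors_vandermonde1 _ v_eigen r0_decomp).
rewrite mul_eigenvectors_const1 -r0_decomp.
(* The real part of the complex minimizer [w] competes in the real problem, where [y] is optimal. *)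
apply: le_trans (yP (map_mx (@complex.Re R) w)) _.
have -> : B *m map_mx (@complex.Re R) w - r =
    map_mx (@complex.Re R) (complexify B *m w - complexify r).
  by rewrite map_mxB Re_complexify_mul complexifyK.
exact: rnorm2_Re.
Qed.
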